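(* Let $\operatorname{nz}(N)$ denote the number of indices $i$ with $1\le i\le N$ such that $a_i=1$, where $\sqrt{2}=\sum_{i} a_i 2^{-i}$ is the binary expansion of $\sqrt{2}$ with digits $a_i\in\{0,1\}$. Then, as $N\to\infty$, \[ \operatorname{nz}(N)\ge \sqrt{2}\,N^{1/2}(1+o(1)). \]
   Context: The binary expansion $\sqrt{2}=\sum_i a_i2^{-i}$ with $a_i\in\{0,1\}$; $\operatorname{nz}(N)$ counts the nonzero digits among the first $N$ binary digits after the binary point. The notation $f(N)=o(g(N))$ means $f(N)/g(N)\to 0$ as $N\to\infty$; thus the claim means $\liminf_{N\to\infty}\operatorname{nz}(N)/\sqrt{N}\ge\sqrt{2}$. *)

(* Defs.v *)
From HB Require Import structures.
From mathcomp Require Import all_boot all_order all_algebra.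
From mathcomp Require Import all_classical all_reals all_analysis.

Set Implicit Arguments.
Unset Strict Implicit.
Unset Printing Implicit Defensive.

Import Order.TTheory GRing.Theory Num.Theory.
Import numFieldNormedType.Exports.

Local Open Scope classical_set_scope.
Local Open Scope ring_scope.

(* The index i starts at 0: a 0 is the integer part, so this covers x in
   [0, 2], and a i for i >= 1 is the i-th digit after the binary point.
   The expansion is not assumed to be the non-terminating (or terminating) one;
   for irrational x it is unique. *)
Definition binary_expansion (R : realType) (a : nat -> nat) (x : R) : Prop :=
  (forall i, a i = 0%N \/ a i = 1%N) /\
  series (fun i => (a i)%:R * 2 ^- i : R) @ \oo --> x.

Definition nz (a : nat -> nat) (N : nat) : nat :=
  (\sum_(1 <= i < N.+1 | a i == 1) 1)%N.

(* Main.v *)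
(* Squaring sqrt 2 = sum a_i 2^-i gives 2 = sum r(n) 2^-n, where r(n) counts the
   pairs of nonzero digits whose positions add up to n. The scaled tails
   T(R) = 2^R sum_(n > R) r(n) 2^-n are integers with 2 T(R) = T(R+1) + r(R+1),
   positive because sqrt 2 is irrational. Let s be the number of nonzero digits
   among a_0, ..., a_N. If T(R) = 1 then r(R) is odd, hence R is even and
   a_(R/2) = 1, which happens for at most s values R < N; for all others
   T(R) >= 2. Summing the recurrence over R < N yields
   2 N - s <= sum r(n) + T(N) <= s^2 + T(N), and T(N) <= 2 s + 4 because
   r(N+m) <= 2 (s + m). Hence sqrt (2 N) <= s + 2. *)

Require Import Defs.
From HB Require Import structures.
From mathcomp Require Import all_boot all_order all_algebra.
From mathcomp Require Import all_classical all_reals all_analysis.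
From mathcomp Require Import zify ring lra.

Import Order.TTheory GRing.Theory Num.Theory.
Import numFieldNormedType.Exports.

Local Open Scope classical_set_scope.
Local Open Scope ring_scope.

Section NatPart.
Local Open Scope nat_scope.

(** * Rearranging finite sums of natural numbers *)

Lemma sum_antidiagonal (F : nat -> nat -> nat) R :
  \sum_(0 <= n < R) \sum_(0 <= i < n.+1) F i (n - i) =
  \sum_(0 <= i < R) \sum_(0 <= j < R - i) F i j.
Proof.
elim: R => [|R IH]; first by rewrite !big_geq.
rewrite big_nat_recr //= IH [RHS]big_nat_recr //= subSnn big_nat1.
rewrite [in LHS]big_nat_recr //= subnn addnA; congr (_ + _).
rewrite -big_split /=; apply: eq_big_nat => i /andP[_ iR].
by rewrite subSn ?(ltnW iR) // big_nat_recr.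
Qed.

Lemma leq_sum_range (F : nat -> nat) m n :
  m <= n -> \sum_(0 <= i < m) F i <= \sum_(0 <= i < n) F i.
Proof. by move=> mn; rewrite (big_cat_nat (leq0n m) mn) /= leq_addr. Qed.

Lemma leq_sum_nat (F G : nat -> nat) n :
  (forall i, i < n -> F i <= G i) ->
  \sum_(0 <= i < n) F i <= \sum_(0 <= i < n) G i.
Proof.
move=> FG; rewrite big_nat_cond [leqRHS]big_nat_cond.
by apply: leq_sum => i /andP[/andP[_ /FG]].
Qed.

Lemma sum_symmetric (F : nat -> nat) n : (forall i, i <= n -> F (n - i) = F i) ->
  \sum_(0 <= i < n.+1) F i =
  (\sum_(0 <= i < uphalf n) F i).*2 + ~~ odd n * F n./2.
Proof.
move=> sF.
have h : uphalf n <= n.+1 by lia.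
rewrite (big_cat_nat (leq0n _) h) /=.
have -> : \sum_(uphalf n <= i < n.+1) F i = \sum_(0 <= i < n./2.+1) F i.
  rewrite big_nat_rev /= -{1}(add0n (uphalf n)) big_addn.
  have -> : n.+1 - uphalf n = n./2.+1 by lia.
  apply: eq_big_nat => i /andP[_ hi].
  have -> : uphalf n + n.+1 - (i + uphalf n).+1 = n - i by lia.
  by apply: sF; lia.
rewrite -addnn -addnA; congr (_ + _).
have [no|no] := boolP (odd n).
  have -> : uphalf n = n./2.+1 by lia.
  by rewrite mul0n addn0.
have -> : uphalf n = n./2 by lia.
by rewrite mul1n big_nat_recr.
Qed.

Variable a : nat -> nat.
Hypothesis a01 : forall i, a i <= 1.

(* With [x] the sum of the [a i / 2 ^ i]: [trunc K / 2 ^ K] is the truncation of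
   [x] after [K] digits, [sqtrunc R / 2 ^ R] the partial sum of the series for
   [x ^ 2] with coefficients [autoconv], and, when [x ^ 2 = 2],
   [defect R / 2 ^ R] is the tail of that series. *)
Definition autoconv n := \sum_(0 <= i < n.+1) a i * a (n - i).
Definition ones n := \sum_(0 <= i < n.+1) a i.
Definition trunc K := \sum_(0 <= i < K.+1) a i * 2 ^ (K - i).
Definition sqtrunc R := \sum_(0 <= n < R.+1) autoconv n * 2 ^ (R - n).
Definition defect R := 2 ^ R.+1 - sqtrunc R.

(** * Parity and size of the digit autoconvolution *)

Lemma autoconvE n : autoconv n =
  (\sum_(0 <= i < uphalf n) a i * a (n - i)).*2 + ~~ odd n * a n./2.
Proof.
rewrite /autoconv sum_symmetric; last by move=> i i_n; rewrite subKn // mulnC.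
congr (_ + _); case: (boolP (odd n)) => //= no; rewrite !mul1n.
have -> : n - n./2 = n./2 by lia.
by have := a01 n./2; case: (a _) => [|[]].
Qed.

Lemma odd_autoconv_le n : odd (autoconv n) <= ~~ odd n * a n./2.
Proof.
rewrite autoconvE oddD odd_double /=.
by have := a01 n./2; case: (odd n); case: (a _) => [|[]].
Qed.

Lemma ones_addn n m : ones (n + m) <= ones n + m.
Proof.
elim: m => [|m IH]; first by rewrite !addn0.
have -> : ones (n + m.+1) = ones (n + m) + a (n + m).+1.
  by rewrite addnS /ones big_nat_recr.
by have := a01 (n + m).+1; lia.
Qed.

(** A pair is determined by its smaller position, at most [n./2], up to order; each position past
    [N] adds at most one nonzero digit. *)
Lemma autoconv_le N m : autoconv (N + m) <= 2 * (ones N + m).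
Proof.
rewrite autoconvE; set n := N + m.
apply: (@leq_trans (2 * ones n./2)); last first.
  rewrite leq_mul2l /=; apply: leq_trans (ones_addn N m).
  by apply: leq_sum_range; lia.
have -> : 2 * ones n./2 = (ones n./2).*2 by lia.
have h : \sum_(0 <= i < uphalf n) a i * a (n - i) <= \sum_(0 <= i < uphalf n) a i.
  by apply: leq_sum_nat => i _; rewrite -[leqRHS]muln1 leq_mul2l a01 orbT.
have [no|no] := boolP (odd n).
  rewrite /= mul0n addn0 leq_double; apply: (leq_trans h).
  by apply: leq_sum_range; lia.
move: h; have -> : uphalf n = n./2 by lia.
by rewrite /ones big_nat_recr //=; lia.
Qed.

(** Only even [n] with a nonzero digit at [n./2] contribute, and [n./2] determines such an [n]. *)
Lemma sum_odd_autoconv_le N : \sum_(0 <= n < N) odd (autoconv n) <= ones N.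
Proof.
have E M : \sum_(0 <= n < M.*2) ~~ odd n * a n./2 = \sum_(0 <= n < M) a n.
  elim: M => [|M IH]; first by rewrite !big_geq.
  rewrite doubleS !big_nat_recr //= IH odd_double /= mul1n doubleK.
  by rewrite mul0n addn0.
rewrite /ones -E; apply: (@leq_trans (\sum_(0 <= n < N) ~~ odd n * a n./2)).
  by apply: leq_sum_nat => i _; exact: odd_autoconv_le.
by apply: leq_sum_range; lia.
Qed.

Lemma sum_autoconv_le N : \sum_(0 <= n < N.+1) autoconv n <= ones N ^ 2.
Proof.
rewrite /autoconv (sum_antidiagonal (fun i j => a i * a j)).
rewrite -mulnn {1}/ones big_distrl /=.
apply: leq_sum_nat => i _; rewrite big_distrr /=.
by apply: leq_sum_range; lia.
Qed.

(** * Squared truncations against partial sums of the squared series *)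

Lemma sqtruncE R : sqtrunc R =
  \sum_(0 <= i < R.+1) \sum_(0 <= j < R.+1 - i) a i * a j * 2 ^ (R - (i + j)).
Proof.
rewrite -(sum_antidiagonal (fun i j => a i * a j * 2 ^ (R - (i + j)))).
apply: eq_big_nat => n _; rewrite /autoconv big_distrl /=.
by apply: eq_big_nat => i /andP[_ hi]; rewrite subnKC.
Qed.

Lemma trunc_sqr K : trunc K ^ 2 =
  \sum_(0 <= i < K.+1) \sum_(0 <= j < K.+1) a i * a j * 2 ^ (K.*2 - (i + j)).
Proof.
rewrite -mulnn {1}/trunc big_distrl /=.
apply: eq_big_nat => i /andP[_ hi]; rewrite big_distrr /=.
apply: eq_big_nat => j /andP[_ hj].
have -> : K.*2 - (i + j) = (K - i) + (K - j) by lia.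
by rewrite expnD mulnACA.
Qed.

(** The triangle [i + j <= R] lies in the square [i, j <= R]. *)
Lemma sqtrunc_le_trunc_sqr R : sqtrunc R * 2 ^ R <= trunc R ^ 2.
Proof.
rewrite sqtruncE trunc_sqr big_distrl /=.
apply: leq_sum_nat => i hi; rewrite big_distrl /=.
apply: (@leq_trans (\sum_(0 <= j < R.+1 - i) a i * a j * 2 ^ (R.*2 - (i + j)))).
  apply: leq_sum_nat => j hj; rewrite -mulnA -expnD.
  by have -> : R - (i + j) + R = R.*2 - (i + j) by lia.
by apply: leq_sum_range; lia.
Qed.

(** The square [i, j <= K] lies in the triangle [i + j <= K.*2]. *)
Lemma trunc_sqr_le_sqtrunc K : trunc K ^ 2 <= sqtrunc K.*2.
Proof.
rewrite sqtruncE trunc_sqr.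
have h : K.+1 <= (K.*2).+1 by lia.
apply: leq_trans (leq_sum_range _ _ _ h).
by apply: leq_sum_nat => i hi; apply: leq_sum_range; lia.
Qed.

Lemma trunc_succ K : trunc K.+1 = 2 * trunc K + a K.+1.
Proof.
rewrite /trunc big_nat_recr //= subnn muln1; congr (_ + _).
rewrite big_distrr /=; apply: eq_big_nat => i /andP[_ hi].
by rewrite subSn // expnS mulnCA.
Qed.

Lemma trunc_lt K : trunc K < 2 ^ K.+1.
Proof.
elim: K => [|K IH]; first by rewrite /trunc big_nat1 muln1; have := a01 0; lia.
by rewrite trunc_succ expnS; have := a01 K.+1; lia.
Qed.

Lemma sqtrunc_succ R : sqtrunc R.+1 = 2 * sqtrunc R + autoconv R.+1.
Proof.
rewrite /sqtrunc big_nat_recr //= subnn muln1; congr (_ + _).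
rewrite big_distrr /=; apply: eq_big_nat => i /andP[_ hi].
by rewrite subSn // expnS mulnCA.
Qed.

(** The exponent of 2 is even in [m ^ 2] and odd in [2 * n ^ 2]. *)
Lemma sqr_neq_double_sqr m n : 0 < n -> m ^ 2 != 2 * n ^ 2.
Proof.
move=> n0; apply/eqP => E.
have m0 : 0 < m by case: m E => //; nia.
have := congr1 (fun k => odd (logn 2 k)) E.
by rewrite lognM ?expn_gt0 ?n0 // !lognX !mul2n oddD !odd_double.
Qed.

(** * The scaled tail, for digits of the square root of 2 *)

Hypothesis trunc_lower : forall K, trunc K ^ 2 <= 2 * (2 ^ K) ^ 2.
Hypothesis trunc_upper : forall K, 2 * (2 ^ K) ^ 2 <= (trunc K).+1 ^ 2.

(** Irrationality gives strictness, so the natural subtraction in [defect] is exact and its value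
    positive. *)
Lemma sqtrunc_lt R : sqtrunc R < 2 ^ R.+1.
Proof.
have p0 : 0 < 2 ^ R by rewrite expn_gt0.
rewrite -(ltn_pmul2r p0); apply: leq_ltn_trans (sqtrunc_le_trunc_sqr R) _.
by rewrite [2 ^ R.+1]expnS -mulnA mulnn ltn_neqAle trunc_lower sqr_neq_double_sqr.
Qed.

Lemma defect_succ R : defect R.+1 + autoconv R.+1 = 2 * defect R.
Proof.
have := sqtrunc_lt R.+1; have := sqtrunc_lt R.
by rewrite /defect sqtrunc_succ [2 ^ R.+2]expnS; lia.
Qed.

(** For positive [R], [defect_succ] gives [defect R] the parity of [autoconv R], so the value 1
    forces an odd coefficient. *)
Lemma defect_odd_ge2 R : 2 <= defect R + odd (autoconv R).
Proof.
have T0 : 0 < defect R by rewrite subn_gt0 sqtrunc_lt.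
case: R T0 => [|R] T0; last first.
  by have := defect_succ R; case: (boolP (odd (autoconv R.+1))); lia.
rewrite /defect /sqtrunc /autoconv !big_nat1 !muln1.
by have := a01 0; case: (a 0) => [|[]].
Qed.

Lemma sum_defect N :
  \sum_(0 <= R < N) defect R + defect 0 + autoconv 0 =
  \sum_(0 <= n < N.+1) autoconv n + defect N.
Proof.
elim: N => [|N IH]; first by rewrite big_geq // big_nat1; lia.
rewrite big_nat_recr //= [in RHS]big_nat_recr //=.
by have := defect_succ N; lia.
Qed.

(** With [t = trunc K], the tail is at most [t.+1 ^ 2 - t ^ 2 = 2 * t + 1], and [t < 2 ^ K.+1]. *)
Lemma defect_double_le K : defect K.*2 <= 2 ^ K.+2.
Proof.
have := trunc_sqr_le_sqtrunc K; have := trunc_upper K; have := trunc_lt K.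
rewrite /defect !expnS -muln2 expnM; set p := 2 ^ K; set t := trunc K.
by move=> *; nia.
Qed.

(* A larger defect would double at each step, against [defect_double_le]. *)
Lemma defect_le N : defect N <= 2 * ones N + 4.
Proof.
rewrite leqNgt; apply/negP => big.
have grow m : 2 ^ m + 2 * (ones N + m) + 4 <= defect (N + m).
  elim: m => [|m IH]; first by rewrite !addn0; lia.
  have := defect_succ (N + m); have := autoconv_le N m.+1.
  by rewrite addnS expnS; lia.
(* After [N + 4] steps the index is the even number [(N.+2).*2], where the upper bound is exactly
   [2 ^ (N + 4)]. *)
have := grow (N + 4); have := defect_double_le N.+2.
have -> : N + (N + 4) = (N.+2).*2 by lia.
by rewrite (addn4 N); lia.
Qed.

Lemma double_le_ones_sqr N : 2 * N <= (ones N + 2) ^ 2.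
Proof.
have h : \sum_(0 <= R < N) 2 <= \sum_(0 <= R < N) (defect R + odd (autoconv R)).
  by apply: leq_sum_nat => R _; exact: defect_odd_ge2.
move: h; rewrite sum_nat_const_nat subn0 big_split /=.
(* With [s = ones N], the bounds add up to [s + s ^ 2 + (2 * s + 4) <= (s + 2) ^ 2]. *)
have := sum_odd_autoconv_le N; have := sum_defect N.
by have := sum_autoconv_le N; have := defect_le N; nia.
Qed.

End NatPart.

Lemma ones_le_nz (a : nat -> nat) N :
  (forall i, (a i <= 1)%N) -> (ones a N <= (nz a N).+1)%N.
Proof.
move=> a01; rewrite /ones /nz big_nat_recl //= -add1n leq_add //.
rewrite big_add1 /= [leqRHS]big_mkcond /=.
by apply: leq_sum_nat => i _; have := a01 i.+1; case: (a _) => [|[]].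
Qed.

(** * From the real expansion to the integer bounds and back *)

Section Reals.
Variable R : realType.
Implicit Types (a : nat -> nat) (x : R).

Lemma series_trunc a K :
  series (fun i => (a i)%:R * 2 ^- i : R) K.+1 = (trunc a K)%:R / 2 ^+ K.
Proof.
rewrite /series /= /trunc natr_sum mulr_suml; apply: eq_big_nat => i /andP[_ iK].
rewrite natrM natrX -mulrA; congr (_ * _).
have {2}-> : K = (K - i + i)%N by rewrite subnK.
by rewrite exprD invfM mulrA divff ?mul1r // expf_neq0 // pnatr_eq0.
Qed.

Lemma binary_expansion_trunc a x K : binary_expansion a x ->
  (trunc a K)%:R <= x * 2 ^+ K <= (trunc a K).+1%:R.
Proof.
case=> a01 ax.
have p0 n : 0 < 2 ^+ n :> R by rewrite exprn_gt0.
(* The dyadic intervals of successive truncations are nested; denominators are cleared. *)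
have bd m : (trunc a K)%:R * 2 ^+ m <= (trunc a (K + m))%:R :> R /\
    (trunc a (K + m))%:R + 1 <= (trunc a K).+1%:R * 2 ^+ m :> R.
  elim: m => [|m [IH1 IH2]]; first by rewrite addn0 expr0 !mulr1 natr1.
  rewrite addnS trunc_succ natrD natrM !exprS.
  have [->|->] := a01 (K + m).+1; split; lra.
have lim (b : R) : (forall m, (trunc a (K + m))%:R / 2 ^+ (K + m) <= b) -> x <= b.
  move=> h; apply: (cvgr_to_le ax); exists K.+1 => // -[|n] //= Kn.
  by rewrite series_trunc -(subnKC (Kn : (K <= n)%N)).
have lim' (b : R) : (forall m, b <= (trunc a (K + m))%:R / 2 ^+ (K + m)) -> b <= x.
  move=> h; apply: (cvgr_to_ge ax); exists K.+1 => // -[|n] //= Kn.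
  by rewrite series_trunc -(subnKC (Kn : (K <= n)%N)).
apply/andP; split.
  rewrite -ler_pdivrMr //; apply: lim' => m.
  rewrite ler_pdivlMr // exprD mulrA mulrVK ?unitfE ?gt_eqF //.
  by have [] := bd m.
rewrite -ler_pdivlMr //; apply: lim => m.
rewrite ler_pdivrMr // exprD mulrA mulrVK ?unitfE ?gt_eqF //.
by have [] := bd m; lra.
Qed.

Lemma sqrt_natr_cvgy : (fun n : nat => Num.sqrt n%:R : R) @ \oo --> +oo.
Proof.
apply/cvgryPge => A; have /cvgryPge/(_ (A ^+ 2)) := @cvgr_idn R.
apply: filterS => n An; apply: le_trans (ler_norm A) _.
by rewrite -sqrtr_sqr ler_wsqrtr.
Qed.

Lemma sqrt_double_le_nz a N : binary_expansion a (Num.sqrt 2 : R) ->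
  Num.sqrt 2 * Num.sqrt N%:R <= (nz a N)%:R + 3 :> R.
Proof.
move=> ha; have a01 i : (a i <= 1)%N by case: ha => /(_ i)[] ->.
have sq K : (Num.sqrt 2 * 2 ^+ K) ^+ 2 = (2 * (2 ^ K) ^ 2)%:R :> R.
  by rewrite exprMn sqr_sqrtr ?ler0n // natrM !natrX.
have lo K : (trunc a K ^ 2 <= 2 * (2 ^ K) ^ 2)%N.
  have /andP[h _] := binary_expansion_trunc _ _ K ha.
  by rewrite -(ler_nat R) -sq natrX ler_pXn2r // ?nnegrE ?ler0n.
have up K : (2 * (2 ^ K) ^ 2 <= (trunc a K).+1 ^ 2)%N.
  have /andP[_ h] := binary_expansion_trunc _ _ K ha.
  by rewrite -(ler_nat R) -sq natrX ler_pXn2r // ?nnegrE ?ler0n.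
have := double_le_ones_sqr a a01 lo up N; have := ones_le_nz a N a01 => h1 h2.
(* The 3 is the 2 of [double_le_ones_sqr] plus 1 for the digit [a 0], which [nz] omits. *)
have h : (2 * N <= (nz a N + 3) ^ 2)%N by nia.
rewrite -sqrtrM ?ler0n // -natrM -natrD -(ger0_norm (ler0n R (nz a N + 3))).
by rewrite -sqrtr_sqr ler_wsqrtr // -natrX ler_nat.
Qed.
End Reals.

Theorem theorem1 (R : realType) (a : nat -> nat)
    (ha : binary_expansion a (Num.sqrt 2 : R)) :
  exists o1 : nat -> R,
    o1 @ \oo --> (0 : R) /\
    \forall N \near \oo,
      Num.sqrt 2 * Num.sqrt N%:R * (1 + o1 N) <= (nz a N)%:R.
Proof.
(* This choice turns the left-hand side into [Num.sqrt 2 * Num.sqrt N%:R - 3] for positive [N]. *)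
exists (fun N => - (3 / Num.sqrt 2) * (Num.sqrt N%:R)^-1); split.
  rewrite -[X in _ --> X](mulr0 (- (3 / Num.sqrt 2))); apply: cvgMr.
  apply/gtr0_cvgV0; last exact: sqrt_natr_cvgy.
  by exists 1%N => // n /= n0; rewrite sqrtr_gt0 ltr0n.
exists 1%N => // N /= N0.
have s2 : Num.sqrt 2 != 0 :> R by rewrite gt_eqF // sqrtr_gt0.
have sN : Num.sqrt N%:R != 0 :> R by rewrite gt_eqF // sqrtr_gt0 ltr0n.
rewrite [leLHS](_ : _ = Num.sqrt 2 * Num.sqrt N%:R - 3); last by field; apply/andP.
by rewrite lerBlDr sqrt_double_le_nz.
Qed.
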